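(* Let $f$ be a monic univariate polynomial of degree $n$ with real coefficients, all of whose complex roots have nonnegative real part and which has at least one root with positive real part. Write $f(x)=\sum_{i=0}^n (-1)^i a_{n-i}x^{n-i}$ with $a_n=1$ and let $f=p-q$ where $$p(x)=\sum_{0\le 2i\le n} a_{n-2i}\,x^{n-2i},\qquad q(x)=\sum_{1\le 2i+1\le n} a_{n-(2i+1)}\,x^{n-(2i+1)}.$$ Let $r_1\le r_2\le\dots\le r_m$ be the real roots of $f$ (counted with multiplicity), and set $r_0=0$, $r_{m+1}=+\infty$. Let $x_0\in\mathbb{R}$ with $x_0>0$ and $x_0\in[r_k,r_{k+1}]$ for some $k\in\{0,1,\dots,m\}$. Then $$x_1=x_0\,\frac{p(x_0)}{q(x_0)}\in[r_k,r_{k+1}]\quad\text{and}\quad x_{-1}=x_0\,\frac{q(x_0)}{p(x_0)}\in[r_k,r_{k+1}].$$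
   Context: Under the hypotheses on the roots of $f$, all coefficients $a_i$ are nonnegative, so $p$ and $q$ have nonnegative coefficients, all real roots of $f$ are nonnegative, and $p(x)>0$, $q(x)>0$ for all $x>0$, so the quotients are well defined. The number $m$ of real roots may be $0$. When $k=m$, the upper endpoint is $r_{m+1}=+\infty$ and membership in $[r_m,+\infty]$ for a real number just means being at least $r_m$. *)

(* Defs.v *)
From HB Require Import structures.
From mathcomp Require Import all_boot all_order all_algebra.
From mathcomp Require Import complex.
From mathcomp Require Import constructive_ereal reals.
Set Implicit Arguments.
Unset Strict Implicit.
Unset Printing Implicit Defensive.
Import Order.TTheory GRing.Theory Num.Theory.
Local Open Scope ring_scope.

(* p and q in f = p - q, for f = \sum_(i <= n) (-1)^i a_(n-i) X^(n-i);
   i < n.+1 is only a range large enough to contain all the i selected by the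
   condition on the right. *)
Definition pos_part (R : realType) (n : nat) (a : nat -> R) : {poly R} :=
  \sum_(i < n.+1 | (2 * i <= n)%N) a (n - 2 * i)%N *: 'X^(n - 2 * i).

Definition neg_part (R : realType) (n : nat) (a : nat -> R) : {poly R} :=
  \sum_(i < n.+1 | (2 * i + 1 <= n)%N)
    a (n - (2 * i + 1))%N *: 'X^(n - (2 * i + 1)).

Definition complex_root (R : realType) (f : {poly R}) (z : R[i]) : bool :=
  root (map_poly (real_complex R) f) z.

Definition real_roots (R : realType) (f : {poly R}) (r : seq R) : Prop :=
  sorted <=%R r /\ forall x : R, count_mem x r = mup x f.

(* r_0 = 0, r_1, ..., r_m, r_(m+1) = +oo, where m = size r and the sequence r,
   indexed from 0, holds r_1, ..., r_m. *)
Definition endpoint (R : realType) (r : seq R) (k : nat) : \bar R :=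
  nth +oo%E (0%:E :: rcons [seq x%:E | x <- r] +oo)%E k.

(* Main.v *)
Require Import Defs.
From HB Require Import structures.
From mathcomp Require Import all_boot all_order all_algebra.
From mathcomp Require Import complex.
From mathcomp Require Import constructive_ereal reals.
From mathcomp Require Import ring lra zify.
Set Implicit Arguments.
Unset Strict Implicit.
Unset Printing Implicit Defensive.
Import Order.TTheory GRing.Theory Num.Theory.
Local Open Scope ring_scope.

(** Since [f = p - q] and [p + q] is, up to sign, [f (- x)], everything is
    governed by the ratio [f x / f (- x)]: over the complex numbers it is, up
    to sign, the product of the factors [(x - z) / (x + z)] over the roots [z]
    of [f].  For [x > 0] and [Re z >= 0] the point [x] is at least as close to
    [z] as to [- z], so every factor has modulus at most 1, and the modulus of
    the product is bounded by that of any one factor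
    ([norm_horner_le_factor]).

    A root with positive real part gives [|p - q| < |p + q|], so that [p] and
    [q] are nonzero of the same sign.  A real root [rho] gives
    [|p - q| (x + rho) <= |x - rho| |p + q|], and this says exactly that
    neither [x p / q] nor [x q / p] lies on the other side of [rho] from [x]
    ([scaled_ratio_same_side]).  The claim on [[r_k, r_(k+1)]] follows, as its
    endpoints are real roots of [f], [0] or [+oo]. *)

Lemma sum_even_odd (V : nmodType) (n : nat) (F : nat -> V) :
  \sum_(i < n.+1) F i =
  \sum_(i < n.+1 | (2 * i <= n)%N) F (2 * i)%N +
  \sum_(i < n.+1 | (2 * i + 1 <= n)%N) F (2 * i + 1)%N.
Proof.
(* Extending [F] by 0 beyond [n] frees the pairing of [2 i] with [2 i + 1]
   from the parity of [n]. *)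
pose G i := if (i <= n)%N then F i else 0.
have pairs m : \sum_(i < 2 * m) G i =
    \sum_(i < m) G (2 * i)%N + \sum_(i < m) G (2 * i + 1)%N.
  elim: m => [|m IHm]; first by rewrite muln0 !big_ord0 addr0.
  have -> : (2 * m.+1 = (2 * m).+2)%N by lia.
  by rewrite !big_ord_recr /= IHm addn1 -!addrA; congr (_ + _);
    rewrite addrCA.
rewrite [in RHS]big_mkcond [X in _ + X]big_mkcond /= -pairs.
rewrite -(big_mkord xpredT G) (big_cat_nat _ (n := n.+1)) //=; last by lia.
rewrite [X in _ + X]big_nat_cond [X in _ + X]big1 ?addr0.
  by rewrite big_mkord; apply: eq_bigr => i _; rewrite /G -ltnS ltn_ord.
by move=> i; rewrite andbT => /andP[ltni _]; rewrite /G leqNgt ltni.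
Qed.

Section SignedParts.
Variables (R : realType) (n : nat) (a : nat -> R) (f : {poly R}).
Hypothesis fE : f = \sum_(i < n.+1) ((-1) ^+ i * a (n - i)%N) *: 'X^(n - i).

Lemma alternating_sum_parts : f = pos_part n a - neg_part n a.
Proof.
rewrite fE (sum_even_odd n (fun i => ((-1) ^+ i * a (n - i)%N) *: 'X^(n - i))).
rewrite -sumrN; congr (_ + _); apply: eq_bigr => i _.
  by rewrite exprM sqrrN !expr1n mul1r.
by rewrite exprD exprM sqrrN !expr1n mul1r expr1 mulN1r scaleNr.
Qed.

Lemma horner_opp_parts x :
  f.[- x] = (-1) ^+ n * ((pos_part n a).[x] + (neg_part n a).[x]).
Proof.
rewrite -hornerD /pos_part /neg_part.
rewrite -(sum_even_odd n (fun i => a (n - i)%N *: 'X^(n - i))).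
rewrite fE !horner_sum mulr_sumr; apply: eq_bigr => -[i /= ltin] _.
have sgn : (-1) ^+ n = (-1) ^+ i * (-1) ^+ (n - i) :> R.
  by rewrite -exprD subnKC.
by rewrite !hornerE (exprNn x) sgn /= mulrACA !mulrA.
Qed.
End SignedParts.

Section RootFactors.
Variable R : realType.
Implicit Types (f : {poly R}) (x : R) (z : R[i]).

Lemma norm_real_complex x : `|x%:C%C| = `|x|%:C%C :> R[i].
Proof. by rewrite normc_def /= expr0n addr0 sqrtr_sqr. Qed.

(** The square of the right side exceeds that of the left by [4 x Re z]. *)
Lemma norm_sub_le_norm_add x z :
  0 <= x -> 0 <= complex.Re z -> `|x%:C%C - z| <= `|x%:C%C + z|.
Proof.
case: z => u v /= x0 u0; rewrite !normc_def /= lecR ler_wsqrtr //.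
nra.
Qed.

Lemma norm_sub_lt_norm_add x z :
  0 < x -> 0 < complex.Re z -> `|x%:C%C - z| < `|x%:C%C + z|.
Proof.
case: z => u v /= x0 u0; rewrite !normc_def /= ltcR ltr_sqrt; nra.
Qed.

(** In [f x / f (- x)], up to sign the product of the factors
    [(x - z) / (x + z)], all factors but the one of [z0] are bounded by 1. *)
Lemma norm_horner_le_factor f x z0 :
  f \is monic -> (forall z, complex_root f z -> 0 <= complex.Re z) ->
  0 <= x -> complex_root f z0 ->
  `|f.[x]|%:C%C * `|x%:C%C + z0| <= `|x%:C%C - z0| * `|f.[- x]|%:C%C.
Proof.
move=> f_monic roots_ge0 x0 rz0.
have [s fs] := closed_field_poly_normal (map_poly (real_complex R) f).
rewrite lead_coef_map (monicP f_monic) rmorph1 scale1r in fs.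
have roots_s z : complex_root f z = (z \in s).
  by rewrite /complex_root fs root_prod_XsubC.
have hornerC y : `|f.[y]|%:C%C = \prod_(z <- s) `|y%:C%C - z|.
  rewrite -norm_real_complex -horner_map fs horner_prod normr_prod.
  by apply: eq_bigr => z _; rewrite hornerXsubC.
have hornerNC : `|f.[- x]|%:C%C = \prod_(z <- s) `|x%:C%C + z|.
  by rewrite hornerC; apply: eq_bigr => z _; rewrite rmorphN -opprD normrN.
rewrite hornerC hornerNC; rewrite roots_s in rz0.
rewrite !(big_rem z0 rz0) /= -[leLHS]mulrA ler_wpM2l //.
rewrite [leLHS]mulrC ler_wpM2l //.
rewrite !big_seq; apply: ler_prod => z sz; rewrite normr_ge0 /=.
by rewrite norm_sub_le_norm_add // roots_ge0 // roots_s (mem_rem sz).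
Qed.

Lemma complex_root_real f x : complex_root f x%:C%C = root f x.
Proof. by rewrite /complex_root fmorph_root. Qed.

(** Isolating a root [z0] with [0 < Re z0] makes the bound by its factor
    strict, since [f (- x)] does not vanish: its roots have nonnegative real
    part and [- x < 0]. *)
Lemma norm_horner_lt_opp f x z0 :
  f \is monic -> (forall z, complex_root f z -> 0 <= complex.Re z) ->
  0 < x -> complex_root f z0 -> 0 < complex.Re z0 ->
  `|f.[x]| < `|f.[- x]|.
Proof.
move=> f_monic roots_ge0 x0 rz0 z0_gt0.
have fNx : 0 < `|f.[- x]|.
  rewrite normr_gt0; apply/negP; rewrite -/(root f _) -complex_root_real.
  by move=> /roots_ge0 /=; rewrite leNgt oppr_lt0 x0.
have := norm_horner_le_factor f_monic roots_ge0 (ltW x0) rz0.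
have ltz := norm_sub_lt_norm_add x0 z0_gt0.
have pos : 0 < `|x%:C%C + z0| by apply: le_lt_trans ltz.
move=> le_f; rewrite -ltcR -(ltr_pM2r pos); apply: le_lt_trans le_f _.
by rewrite mulrC ltr_pM2l // ltcR.
Qed.

Lemma norm_horner_le_real_factor f x rho :
  f \is monic -> (forall z, complex_root f z -> 0 <= complex.Re z) ->
  0 < x -> root f rho ->
  `|f.[x]| * (x + rho) <= `|x - rho| * `|f.[- x]|.
Proof.
move=> f_monic roots_ge0 x0; rewrite -complex_root_real => rrho.
have := norm_horner_le_factor f_monic roots_ge0 (ltW x0) rrho.
rewrite -rmorphD -rmorphB !norm_real_complex -!rmorphM lecR.
by apply: le_trans; rewrite ler_wpM2l ?ler_norm.
Qed.
End RootFactors.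

(** With [u = P / Q], the bound at [rho] reads
    [`|u - 1| (x + rho) <= `|x - rho| (u + 1)].  For [rho <= x] and [u <= 1] it
    simplifies to [rho <= x u], for [x <= rho] and [1 <= u] to [x u <= rho]; in
    the two other cases the conclusion is clear.  As the bound is symmetric in
    [P] and [Q], the lemma serves for [x Q / P] as well. *)
Lemma scaled_ratio_same_side (R : realFieldType) (x rho P Q : R) :
  0 < x -> 0 <= rho -> 0 < P / Q ->
  `|P - Q| * (x + rho) <= `|x - rho| * `|P + Q| ->
  (rho <= x -> rho <= x * (P / Q)) /\ (x <= rho -> x * (P / Q) <= rho).
Proof.
move=> x0 rho0 u0.
have Q0 : Q != 0 by apply: contraTneq u0 => ->; rewrite invr0 mulr0 ltxx.
have nQ0 : 0 < `|Q| by rewrite normr_gt0.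
have PE : P = P / Q * Q by rewrite divfK.
move: (P / Q) u0 PE => u u0 ->.
rewrite (_ : u * Q - Q = (u - 1) * Q); last by ring.
rewrite (_ : u * Q + Q = (u + 1) * Q); last by ring.
rewrite !normrM.
rewrite mulrAC mulrA ler_pM2r // (ger0_norm (_ : 0 <= u + 1)); last by lra.
move=> le_u; split=> xr; move: le_u.
  rewrite (ger0_norm (_ : 0 <= x - rho)) ?subr_ge0 //.
  by case: ger0P => u1; nra.
rewrite (ler0_norm (_ : x - rho <= 0)) ?subr_le0 //.
by case: ger0P => u1; nra.
Qed.

(** The squares of the two norms differ by [4 P Q]. *)
Lemma divr_gt0_norm_subD (R : realFieldType) (P Q : R) :
  `|P - Q| < `|P + Q| -> 0 < P / Q.
Proof.
move=> ltPQ.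
have Q0 : Q != 0 by apply: contraTneq ltPQ => ->; rewrite subr0 addr0 ltxx.
have : 0 < P * Q.
  move: ltPQ; rewrite -ltr_sqr ?nnegrE // !real_normK ?num_real //; nra.
have -> : P * Q = P / Q * Q ^+ 2 by field.
by rewrite pmulr_lgt0 // exprn_even_gt0.
Qed.

Lemma endpoint_itv (R : realType) (r : seq R) k (x y : R) :
  (k <= size r)%N -> 0 < y ->
  (forall rho, rho \in r ->
     (rho <= x -> rho <= y) /\ (x <= rho -> y <= rho)) ->
  x%:E \in `[endpoint r k, endpoint r k.+1] ->
  y%:E \in `[endpoint r k, endpoint r k.+1].
Proof.
move=> k_le y0 same; rewrite !in_itv /= => /andP[lo hi]; apply/andP; split.
  case: k k_le lo {hi} => [|k] k_lt.
    by rewrite /endpoint /= !lee_fin (ltW y0).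
  rewrite /endpoint /= nth_rcons size_map k_lt (nth_map 0) // !lee_fin.
  exact: (same _ (mem_nth 0 k_lt)).1.
move: hi; rewrite /endpoint /= nth_rcons size_map.
have [k_lt|] := ltnP k (size r); last by rewrite if_same !leey.
rewrite (nth_map 0) // !lee_fin.
exact: (same _ (mem_nth 0 k_lt)).2.
Qed.

Theorem theorem1 (R : realType) (n : nat) (f : {poly R}) (a : nat -> R)
  (r : seq R) (k : nat) (x0 : R)
  (f_monic : f \is monic)
  (f_deg : size f = n.+1)
  (roots_ge0 : forall z : R[i], complex_root f z -> 0 <= complex.Re z)
  (root_gt0 : exists2 z : R[i], complex_root f z & 0 < complex.Re z)
  (an1 : a n = 1)
  (fE : f = \sum_(i < n.+1) ((-1) ^+ i * a (n - i)%N) *: 'X^(n - i))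
  (r_roots : real_roots f r)
  (k_le : (k <= size r)%N)
  (x0_gt0 : 0 < x0)
  (x0_in : x0%:E \in `[endpoint r k, endpoint r k.+1]) :
  let p := pos_part n a in
  let q := neg_part n a in
  (x0 * (p.[x0] / q.[x0]))%:E \in `[endpoint r k, endpoint r k.+1] /\
  (x0 * (q.[x0] / p.[x0]))%:E \in `[endpoint r k, endpoint r k.+1].
Proof.
case: root_gt0 => z0 rz0 z0_gt0 p q.
have fx : f.[x0] = p.[x0] - q.[x0].
  by rewrite (alternating_sum_parts fE) hornerD hornerN.
have fNx : `|f.[- x0]| = `|p.[x0] + q.[x0]|.
  by rewrite (horner_opp_parts fE) normrM normr_sign mul1r.
have lt_pq : `|p.[x0] - q.[x0]| < `|p.[x0] + q.[x0]|.
  by rewrite -fx -fNx (norm_horner_lt_opp f_monic roots_ge0 x0_gt0 rz0).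
have le_pq rho : rho \in r -> 0 <= rho /\
    `|p.[x0] - q.[x0]| * (x0 + rho) <= `|x0 - rho| * `|p.[x0] + q.[x0]|.
  move=> rrho; have rt : root f rho.
    apply: contraLR rrho => /mupNroot; rewrite -(r_roots.2 rho) => /eqP.
    by rewrite -leqn0 leqNgt -has_count has_pred1.
  split; first by apply: (roots_ge0 rho%:C%C); rewrite complex_root_real.
  by rewrite -fx -fNx norm_horner_le_real_factor.
have pq_gt0 := divr_gt0_norm_subD lt_pq.
have qp_gt0 : 0 < q.[x0] / p.[x0] by rewrite -invf_div invr_gt0.
split.
  apply: (endpoint_itv k_le (mulr_gt0 x0_gt0 pq_gt0) _ x0_in) => rho.
  by move=> /le_pq[rho0 le]; apply: scaled_ratio_same_side.
apply: (endpoint_itv k_le (mulr_gt0 x0_gt0 qp_gt0) _ x0_in) => rho.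
move=> /le_pq[rho0 le]; apply: scaled_ratio_same_side => //.
by rewrite distrC [q.[x0] + _]addrC.
Qed.
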